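(* For each $n\in\mathbb{N}$ such that $n\geqslant 2$, there is a finite non-commutative Clifford semigroup whose commuting graph has chromatic number equal to $n$.
   Context: A semigroup $S$ is a Clifford semigroup if it is equipped with a unary operation $x\mapsto x^{-1}$ such that for all $x,y\in S$: $(x^{-1})^{-1}=x$, $xx^{-1}x=x$, $x^{-1}x=xx^{-1}$, and $(xx^{-1})(yy^{-1})=(yy^{-1})(xx^{-1})$. Equivalently, $S$ is regular and all its idempotents are central. The center of $S$ is $Z(S)=\{x\in S: xy=yx \text{ for all } y\in S\}$. The commuting graph of a finite non-commutative semigroup $S$ is the simple graph with vertex set $S\setminus Z(S)$ in which two distinct vertices $x,y$ are adjacent if and only if $xy=yx$. The chromatic number of a simple graph is the minimum number of colours needed to colour its vertices so that adjacent vertices have distinct colours. *)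

(* Defs.v *)
From HB Require Import structures.
From mathcomp Require Import all_boot.
Set Implicit Arguments.
Unset Strict Implicit.
Unset Printing Implicit Defensive.

Local Open Scope group_scope.

#[short(type="finSemigroupType")]
HB.structure Definition FinSemigroup := {S of Semigroup S & Finite S}.

(* The operation is existentially quantified, since the library's [_^-1]
   presupposes an identity element. *)
Definition clifford (S : semigroupType) : Prop :=
  exists inv : S -> S,
    [/\ forall x, inv (inv x) = x,
        forall x, x * inv x * x = x,
        forall x, inv x * x = x * inv x &
        forall x y, (x * inv x) * (y * inv y) = (y * inv y) * (x * inv x)].

Definition noncommutative (S : semigroupType) : Prop :=
  ~ (forall x y : S, commute x y).

Definition center (S : finSemigroupType) : {set S} :=
  [set x | [forall y : S, x * y == y * x]].

Record sgraph := SGraph {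
  vertex :> finType;
  edge : rel vertex;
  edge_sym : symmetric edge;
  edge_irr : irreflexive edge
}.

Definition proper_coloring (G : sgraph) k (c : {ffun G -> 'I_k}) : bool :=
  [forall u, forall v, edge u v ==> (c u != c v)].

Definition colorable (G : sgraph) (k : nat) : bool :=
  [exists c : {ffun G -> 'I_k}, proper_coloring c].

Fact colorable_card (G : sgraph) : exists k, colorable G k.
Proof.
exists #|G|; apply/existsP; exists [ffun x => enum_rank x].
apply/forallP=> u; apply/forallP=> v; apply/implyP=> uv.
rewrite !ffunE (inj_eq enum_rank_inj); apply: contraTneq uv => ->.
by rewrite edge_irr.
Qed.

Definition chromatic_number (G : sgraph) : nat := ex_minn (colorable_card G).

Section CommutingGraph.
Variable S : finSemigroupType.

Definition noncentral : finType := {x : S | x \notin center S}.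

Definition commuting_edge : rel noncentral :=
  fun u v => (u != v) && (val u * val v == val v * val u).

Fact commuting_edge_sym : symmetric commuting_edge.
Proof. by move=> u v; rewrite /commuting_edge eq_sym [_ * _ == _]eq_sym. Qed.

Fact commuting_edge_irr : irreflexive commuting_edge.
Proof. by move=> u; rewrite /commuting_edge eqxx. Qed.

Definition commuting_graph : sgraph :=
  SGraph commuting_edge_sym commuting_edge_irr.

End CommutingGraph.

(* Main.v *)
(* Glue the abelian group Z_(n-1) x C_2 on top of the dihedral group D of order
   6, along the homomorphism that sends the generator of C_2 to a reflection s.
   The n - 1 top elements above s are non-central, commute with each other and
   with s, and with no other non-central element of D; so the commuting graph
   is a clique of size n, one edge (the two rotations) and two isolated
   vertices (the other reflections). *)
From HB Require Import structures.
Require Import Defs.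
From mathcomp Require Import all_boot all_algebra.
Set Implicit Arguments.
Unset Strict Implicit.
Unset Printing Implicit Defensive.

Import GRing.Theory.

(** A proper colouring composed with [g] is injective. *)
Lemma clique_leq_chromatic (T : finType) (G : sgraph) (g : T -> G) :
  (forall x y, x != y -> edge (g x) (g y)) -> #|T| <= chromatic_number G.
Proof.
move=> gE; rewrite /chromatic_number; case: ex_minnP => k /existsP[c /forallP cP] _.
suff c_inj : injective (c \o g) by have := leq_card _ c_inj; rewrite card_ord.
move=> x y /= /eqP; apply: contraTeq => /gE.
by have /forallP/(_ (g y))/implyP := cP (g x).
Qed.

Lemma chromatic_leq (G : sgraph) k (c : G -> 'I_k) :
  (forall u v, edge u v -> c u != c v) -> chromatic_number G <= k.
Proof.
move=> cP; rewrite /chromatic_number; case: ex_minnP => l _; apply.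
apply/existsP; exists [ffun x => c x].
by apply/forallP=> u; apply/forallP=> v; apply/implyP=> /cP; rewrite !ffunE.
Qed.

Section Dihedral.
Local Open Scope ring_scope.

(* [(a, e)] stands for [r^a s^e], with [r] a rotation and [s] a reflection. *)
Definition dih := ('Z_3 * bool)%type.

Definition dmul (x y : dih) : dih :=
  (x.1 + (if x.2 then - y.1 else y.1), x.2 (+) y.2).

Definition dinv (x : dih) : dih := (if x.2 then x.1 else - x.1, x.2).

Lemma dmulA : associative dmul.
Proof.
by case=> a [] [b []] [c []]; rewrite /dmul /= ?opprD ?opprK !addrA.
Qed.

Lemma dmul1l x : dmul (0, false) x = x.
Proof. by case: x => a e; rewrite /dmul /= add0r. Qed.

Lemma dmul1r x : dmul x (0, false) = x.
Proof. by case: x => a [] /=; rewrite /dmul /= ?oppr0 addr0. Qed.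

Lemma dinvK : involutive dinv.
Proof. by case=> a [] /=; rewrite /dinv /= ?opprK. Qed.

Lemma dmulV x : dmul x (dinv x) = (0, false).
Proof. by case: x => a [] /=; rewrite /dmul /= subrr. Qed.

Lemma dmulVl x : dmul (dinv x) x = (0, false).
Proof. by case: x => a [] /=; rewrite /dmul /= ?subrr ?addNr. Qed.

(** As 3 is odd, a reflection commutes only with itself and the identity; the rotations form an
    abelian subgroup. All 36 pairs are checked. *)
Lemma dcommE x y : (dmul x y == dmul y x) =
  [|| x == (0, false), y == (0, false), x == y | ~~ x.2 && ~~ y.2].
Proof.
by case: x y => [[[|[|[|//]]] ?] []] [[[|[|[|//]]] ?] []].
Qed.

End Dihedral.

Section Glue.
Variable m : nat.

Definition glue := (('I_m.+1 * bool) + dih)%type.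

HB.instance Definition _ := Finite.copy glue (('I_m.+1 * bool) + dih)%type.

Definition glue_proj (x : glue) : dih :=
  match x with inl (_, e) => (0%R, e) | inr y => y end.

(** A strong semilattice of two groups: mixed products are computed in D. *)
Definition glue_mul (x y : glue) : glue :=
  match x, y with
  | inl (i, e), inl (j, f) => inl ((i + j)%R, e (+) f)
  | _, _ => inr (dmul (glue_proj x) (glue_proj y))
  end.

Definition glue_inv (x : glue) : glue :=
  match x with inl (i, e) => inl ((- i)%R, e) | inr y => inr (dinv y) end.

Lemma glue_projM x y :
  glue_proj (glue_mul x y) = dmul (glue_proj x) (glue_proj y).
Proof.
by case: x y => [[i []]|x] [[j f]|y] //=; rewrite /dmul /= ?oppr0 addr0.
Qed.

Lemma glue_mulA : associative glue_mul.
Proof.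
(* With a factor in D, both sides are the [inr] of a side of [pA]; only three top factors remain. *)
move=> x y z; have pA : dmul (glue_proj x) (glue_proj (glue_mul y z)) =
    dmul (glue_proj (glue_mul x y)) (glue_proj z).
  by rewrite !glue_projM dmulA.
case: x y z pA => [[i e]|x] [[j f]|y] [[k g]|z] /= pA; rewrite ?pA //.
by rewrite addrA addbA.
Qed.

HB.instance Definition _ := isSemigroup.Build glue glue_mulA.

Definition glue_semigroup : finSemigroupType := glue.

Local Open Scope group_scope.

Lemma glue_mulE (x y : glue) : x * y = glue_mul x y.
Proof. by []. Qed.

(** Each [x * glue_inv x] is the identity of the group containing [x], and the two identities
    commute. *)
Lemma glue_clifford : clifford glue.
Proof.
exists glue_inv; split.
- by case=> [[i e]|x] /=; rewrite ?opprK ?dinvK.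
- case=> [[i e]|x]; rewrite !glue_mulE /=; first by rewrite subrr add0r addbb.
  by rewrite dmulV dmul1l.
- case=> [[i e]|x]; rewrite !glue_mulE /=; first by rewrite subrr addNr.
  by rewrite dmulV dmulVl.
- by case=> [[i e]|x] [[j f]|y]; rewrite !glue_mulE /= ?subrr ?addbb ?dmulV.
Qed.

(* Commutation is pulled back from D, since the top group is abelian. *)
Lemma glue_commE (x y : glue) : (x * y == y * x) =
  (dmul (glue_proj x) (glue_proj y) == dmul (glue_proj y) (glue_proj x)).
Proof.
case: x y => [[i e]|x] [[j f]|y]; rewrite !glue_mulE //=.
by rewrite addrC addbC eqxx dcommE /= orbC; case: e f => [] [].
Qed.

Lemma glue_centerE (x : glue) :
  (x \in center glue_semigroup) = (glue_proj x == (0%R, false)).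
Proof.
rewrite inE; apply/forallP/eqP=> [xC | x0 y]; last first.
  by rewrite glue_commE x0 dmul1l dmul1r.
(* Commuting with a rotation of order 3 excludes reflections; commuting with s then excludes
   nontrivial rotations. *)
have := xC (inr (1%R, false)); have := xC (inr (0%R, true)).
rewrite !glue_commE !dcommE /=.
by case: (glue_proj x) => [[[|[|[|//]]] ?] []] //= _ _; congr (_, _); apply: val_inj.
Qed.

Lemma glue_edgeE (u v : commuting_graph glue_semigroup) : edge u v =
  (u != v) && ((glue_proj (val u) == glue_proj (val v))
               || ~~ (glue_proj (val u)).2 && ~~ (glue_proj (val v)).2).
Proof.
rewrite /= /commuting_edge glue_commE dcommE.
have := valP u; have := valP v; rewrite !glue_centerE.
by move=> /negPf-> /negPf->.
Qed.

Lemma glue_noncommutative : noncommutative glue.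
Proof.
move=> /(_ (inr (0%R, true)) (inr (1%R, false))) /eqP.
by rewrite glue_commE dcommE.
Qed.

(** [None] indexes s itself, [Some i] the elements above s. *)
Definition clique_elt (o : option 'I_m.+1) : glue :=
  if o is Some i then inl (i, true) else inr (0%R, true).

Fact clique_elt_noncentral o : clique_elt o \notin center glue_semigroup.
Proof. by rewrite glue_centerE; case: o. Qed.

(** Colour [ord0] is kept for D, except that one rotation borrows a top colour to differ from its
    inverse; no top vertex is adjacent to it. *)
Definition glue_color (x : glue) : 'I_m.+2 :=
  match x with
  | inl (i, _) => lift ord0 i
  | inr y => if y == (1%R, false) then lift ord0 ord0 else ord0
  end.

Lemma glue_chromatic : chromatic_number (commuting_graph glue_semigroup) = m.+2.
Proof.
apply/eqP; rewrite eqn_leq; apply/andP; split.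
  apply: (@chromatic_leq (commuting_graph glue_semigroup) _
           (fun u => glue_color (val u))) => u v.
  rewrite glue_edgeE -val_eqE; have := valP u; have := valP v.
  rewrite !glue_centerE.
  case: (val u) (val v) => [[i []]|x] [[j []]|y] //=.
  - by move=> _ _ /andP[+ _]; apply: contraNneq => /lift_inj->.
  (* The only neighbour in D of a top vertex is s, coloured [ord0]. *)
  - by move=> _ _; rewrite orbF; case: eqP => // <-.
  - by move=> _ _; rewrite andbF orbF; case: eqP => // ->.
  by case: x y => [[[|[|[|//]]] ?] []] [[[|[|[|//]]] ?] []].
have -> : m.+2 = #|{: option 'I_m.+1}| by rewrite card_option card_ord.
apply: (@clique_leq_chromatic _ _
  (fun o => Sub (clique_elt o) (clique_elt_noncentral o)
            : commuting_graph glue_semigroup)) => o o' neq.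
rewrite glue_edgeE -val_eqE !SubK.
case: o o' neq => [i|] [j|] //= neq.
by rewrite andbT; apply: contraNneq neq => -[->].
Qed.

End Glue.

Theorem theorem5p4 (n : nat) (hn : 2 <= n) :
  exists S : finSemigroupType,
    [/\ noncommutative S, clifford S & chromatic_number (commuting_graph S) = n].
Proof.
(* With n = m + 2, the cyclic factor has order m + 1 = n - 1. *)
case: n hn => [|[|m]] // _; exists (glue_semigroup m).
by split; [apply: glue_noncommutative | apply: glue_clifford | apply: glue_chromatic].
Qed.
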